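(* Let $K$ be a field and let $(\mathcal C,\mathbb E,\mathfrak s)$ be an essentially small $K$-linear Krull-Schmidt extriangulated category, and let $\mathcal G$ be a generator or a cogenerator of $\mathcal C$. Then there is a one-to-one correspondence between the following sets: (1) dense $\mathcal G$-resolving subcategories of $\mathcal C$; (2) dense $\mathcal G$-coresolving subcategories of $\mathcal C$; (3) subgroups of $K_0(\mathcal C)$ containing the image of $\mathcal G$ (i.e. containing the class $[G]$ for every $G\in\mathcal G$).
   Context: Extriangulated categories (Nakaoka-Palu). Let $\mathcal C$ be an additive category with a biadditive functor $\mathbb E:\mathcal C^{\mathrm{op}}\times\mathcal C\to \mathrm{Ab}$. An element $\delta\in\mathbb E(C,A)$ is an $\mathbb E$-extension; for $a:A\to A'$ and $c:C'\to C$ write $a_*\delta=\mathbb E(C,a)(\delta)$, $c^*\delta=\mathbb E(c,A)(\delta)$. A morphism from $\delta\in\mathbb E(C,A)$ to $\delta'\in\mathbb E(C',A')$ is a pair $(a,c)$, $a:A\to A'$, $c:C\to C'$, with $a_*\delta=c^*\delta'$. Sequences $A\to B\to C$ and $A\to B'\to C$ are equivalent if there is an isomorphism $B\cong B'$ compatible with the maps from $A$ and to $C$. A realization $\mathfrak s$ assigns to each $\delta\in\mathbb E(C,A)$ an equivalence class $\mathfrak s(\delta)=[A\xrightarrow{x}B\xrightarrow{y}C]$ such that for every morphism $(a,c):\delta\to\delta'$, with $\mathfrak s(\delta')=[A'\xrightarrow{x'}B'\xrightarrow{y'}C']$, there is $b:B\to B'$ with $bx=x'a$, $y'b=cy$ (one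 says $(a,b,c)$ realizes $(a,c)$). It is additive if $\mathfrak s(0)=[A\to A\oplus C\to C]$ (canonical maps) and $\mathfrak s(\delta\oplus\delta')=\mathfrak s(\delta)\oplus\mathfrak s(\delta')$. The triple $(\mathcal C,\mathbb E,\mathfrak s)$ is extriangulated if: (ET1) $\mathbb E$ is a biadditive functor. (ET2) $\mathfrak s$ is an additive realization. (ET3) If $\mathfrak s(\delta)=[A\xrightarrow{x}B\xrightarrow{y}C]$, $\mathfrak s(\delta')=[A'\xrightarrow{x'}B'\xrightarrow{y'}C']$ and $bx=x'a$, there is $c:C\to C'$ such that $(a,c):\delta\to\delta'$ is a morphism realized by $(a,b,c)$. (ET3)$^{\mathrm{op}}$: if $y'b=cy$, there is $a:A\to A'$ such that $(a,c):\delta\to\delta'$ is a morphism realized by $(a,b,c)$. (ET4) If $\delta\in\mathbb E(D,A)$, $\delta'\in\mathbb E(F,B)$ are realized by $A\xrightarrow{f}B\xrightarrow{f'}D$ and $B\xrightarrow{g}C\xrightarrow{g'}F$, there are an object $E$, morphisms $h=gf:A\to C$, $h':C\to E$, $d:D\to E$, $e:E\to F$ with $h'g=df'$, $eh'=g'$, and $\delta''\in\mathbb E(E,A)$ realized by $A\xrightarrow{h}C\xrightarrow{h'}E$, such that $D\xrightarrow{d}E\xrightarrow{e}F$ realizes $f'_*\delta'$, $d^*\delta''=\delta$ and $f_*\delta''=e^*\delta'$. (ET4)$^{\mathrm{op}}$ If $\delta\in\mathbb E(B,D)$, $\delta'\in\mathbb E(C,F)$ are realized by $D\xrightarrow{f'}A\xrightarrow{f}B$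 and $F\xrightarrow{g'}B\xrightarrow{g}C$, there are an object $E$, morphisms $d:D\to E$, $e:E\to F$, $h':E\to A$, $h=gf:A\to C$ with $h'd=f'$, $fh'=g'e$, and $\delta''\in\mathbb E(C,E)$ realized by $E\xrightarrow{h'}A\xrightarrow{h}C$, such that $D\xrightarrow{d}E\xrightarrow{e}F$ realizes $g'^*\delta$, $\delta'=e_*\delta''$ and $d_*\delta=g^*\delta''$. If $A\xrightarrow{x}B\xrightarrow{y}C$ realizes $\delta\in\mathbb E(C,A)$, the data $A\xrightarrow{x}B\xrightarrow{y}C\overset{\delta}{\dashrightarrow}$ is called an $\mathbb E$-triangle. All subcategories are full additive subcategories closed under isomorphisms. A set $\mathcal G$ of objects of $\mathcal C$ is a generator of $\mathcal C$ if for every $A\in\mathcal C$ there is an $\mathbb E$-triangle $A_1\to G\to A\dashrightarrow$ with $G\in\mathcal G$; it is a cogenerator if for every $A\in\mathcal C$ there is an $\mathbb E$-triangle $A\to G\to A_1\dashrightarrow$ with $G\in\mathcal G$. A subcategory $\mathcal X\subset\mathcal C$ is dense if $\mathrm{add}(\mathcal X)=\mathcal C$, i.e. every object of $\mathcal C$ is a direct summand of an object of $\mathcal X$. $\mathcal X$ is $\mathcal G$-resolving if (i) for every $\mathbb E$-triangle $A\to B\to C\dashrightarrow$ with $A,C\in\mathcal X$ one has $B\in\mathcal X$; (ii) for every $\mathbb E$-triangle $A\to B\to C\dashrightarrow$ with $B,C\in\mathcal X$ one has $A\in\mathcal X$; (iii) $\mathcal G\subset\mathcal X$. $\mathcal X$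 is $\mathcal G$-coresolving if (i) and (iii) hold and for every $\mathbb E$-triangle $A\to B\to C\dashrightarrow$ with $A,B\in\mathcal X$ one has $C\in\mathcal X$. $K_0(\mathcal C)$ is the quotient of the free abelian group on isomorphism classes $[X]$ of objects of $\mathcal C$ by the subgroup generated by all $[A]+[C]-[B]$ with $A\to B\to C\dashrightarrow$ an $\mathbb E$-triangle. *)

(* Defs.v *)
From HB Require Import structures.
From mathcomp Require Import all_boot all_algebra.
From mathcomp Require Import freeg.
From mathcomp Require Import boolp classical_sets functions.

Set Implicit Arguments.
Unset Strict Implicit.
Unset Printing Implicit Defensive.

Import GRing.Theory.
Local Open Scope classical_set_scope.
Local Open Scope ring_scope.

Declare Scope lincat_scope.
Delimit Scope lincat_scope with LC.
Local Open Scope lincat_scope.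

Reserved Notation "g \oc f" (at level 40, left associativity).
Reserved Notation "X \bs Y" (at level 50, left associativity).

(* The zero object and the binary biproducts are chosen; nothing below depends
   on the choice up to isomorphism. *)
Record linearCategory (K : fieldType) := LinearCategory {
  obj :> Type;
  hom : obj -> obj -> lmodType K;
  idm : forall X, hom X X;
  hcomp : forall X Y Z, hom Y Z -> hom X Y -> hom X Z;
  hcomp1l : forall X Y (f : hom X Y), hcomp (idm Y) f = f;
  hcomp1r : forall X Y (f : hom X Y), hcomp f (idm X) = f;
  hcompA : forall X Y Z W (h : hom Z W) (g : hom Y Z) (f : hom X Y),
    hcomp h (hcomp g f) = hcomp (hcomp h g) f;
  hcomp_linl : forall X Y Z (k : K) (g g' : hom Y Z) (f : hom X Y),
    hcomp (k *: g + g') f = k *: hcomp g f + hcomp g' f;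
  hcomp_linr : forall X Y Z (k : K) (g : hom Y Z) (f f' : hom X Y),
    hcomp g (k *: f + f') = k *: hcomp g f + hcomp g f';
  zobj : obj;
  zobj_initial : forall X (f : hom zobj X), f = 0;
  zobj_terminal : forall X (f : hom X zobj), f = 0;
  bsum : obj -> obj -> obj;
  inl_ : forall X Y, hom X (bsum X Y);
  inr_ : forall X Y, hom Y (bsum X Y);
  prl : forall X Y, hom (bsum X Y) X;
  prr : forall X Y, hom (bsum X Y) Y;
  prl_inl : forall X Y, hcomp (prl X Y) (inl_ X Y) = idm X;
  prr_inr : forall X Y, hcomp (prr X Y) (inr_ X Y) = idm Y;
  prr_inl : forall X Y, hcomp (prr X Y) (inl_ X Y) = 0;
  prl_inr : forall X Y, hcomp (prl X Y) (inr_ X Y) = 0;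
  bsum_id : forall X Y, hcomp (inl_ X Y) (prl X Y) + hcomp (inr_ X Y) (prr X Y)
                        = idm (bsum X Y)
}.

Arguments idm {K l} X.
Arguments inl_ {K l} X Y.
Arguments inr_ {K l} X Y.
Arguments prl {K l} X Y.
Arguments prr {K l} X Y.
Arguments zobj {K l}.

Notation "g \oc f" := (hcomp g f) : lincat_scope.
Notation "X \bs Y" := (bsum X Y) : lincat_scope.

Section Category.
Context (K : fieldType) (C : linearCategory K).
Implicit Types A B X Y Z : C.

Definition is_iso X Y (f : hom X Y) : Prop :=
  exists g : hom Y X, g \oc f = idm X /\ f \oc g = idm Y.

Definition isomorphic X Y : Prop := exists f : hom X Y, is_iso f.

Definition bsum_map X X' Y Y' (f : hom X X') (g : hom Y Y') :
    hom (X \bs Y) (X' \bs Y') :=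
  inl_ X' Y' \oc f \oc prl X Y + inr_ X' Y' \oc g \oc prr X Y.

Definition direct_summand A X : Prop :=
  exists B, isomorphic X (A \bs B).

(* End(X) is a local ring: it is nonzero and its non-units are closed under
   addition. *)
Definition local_endo X : Prop :=
  idm X <> 0 /\
  forall f g : hom X X, ~ is_iso f -> ~ is_iso g -> ~ is_iso (f + g).

Definition krull_schmidt : Prop :=
  forall X, exists s : seq C,
    (forall i : 'I_(size s), local_endo (tnth (in_tuple s) i)) /\
    isomorphic X (foldr (@bsum K C) zobj s).

Definition full_additive_subcategory (S : set C) : Prop :=
  [/\ S zobj,
      forall X Y, S X -> S Y -> S (X \bs Y) &
      forall X Y, isomorphic X Y -> S X -> S Y].

Definition dense (S : set C) : Prop :=
  forall A, exists X, S X /\ direct_summand A X.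

(* Essential smallness, given as data: a set of isomorphism classes of
   objects. *)
Record essentially_small := EssentiallySmall {
  isoclass :> choiceType;
  iso_cls : C -> isoclass;
  iso_clsE : forall X Y, iso_cls X = iso_cls Y <-> isomorphic X Y;
  iso_cls_surj : forall i, exists X, iso_cls X = i
}.

Record sequence (A Z : C) := Sequence {
  seq_mid : C;
  seq_in : hom A seq_mid;
  seq_out : hom seq_mid Z
}.

Definition seq_equiv A Z (s t : sequence A Z) : Prop :=
  exists b : hom (seq_mid s) (seq_mid t),
    [/\ is_iso b, b \oc seq_in s = seq_in t & seq_out t \oc b = seq_out s].

Definition seq_class A Z (s : sequence A Z) : set (sequence A Z) :=
  [set t | seq_equiv s t].

Definition split_seq A Z : sequence A Z := Sequence (inl_ A Z) (prr A Z).

Definition bsum_seq A Z A' Z' (s : sequence A Z) (t : sequence A' Z') :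
    sequence (A \bs A') (Z \bs Z') :=
  Sequence (bsum_map (seq_in s) (seq_in t)) (bsum_map (seq_out s) (seq_out t)).

(* (ET1); [Ext Z A] is E(Z, A), contravariant in its first argument. *)
Record biadditive_functor := BiadditiveFunctor {
  Ext :> C -> C -> zmodType;
  push : forall Z A A', hom A A' -> Ext Z A -> Ext Z A';
  pull : forall Z Z' A, hom Z' Z -> Ext Z A -> Ext Z' A;
  push1 : forall Z A (d : Ext Z A), push (idm A) d = d;
  push_comp : forall Z A A' A'' (a' : hom A' A'') (a : hom A A') (d : Ext Z A),
    push (a' \oc a) d = push a' (push a d);
  pull1 : forall Z A (d : Ext Z A), pull (idm Z) d = d;
  pull_comp : forall Z Z' Z'' A (c : hom Z' Z) (c' : hom Z'' Z') (d : Ext Z A),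
    pull (c \oc c') d = pull c' (pull c d);
  push_pull : forall Z Z' A A' (a : hom A A') (c : hom Z' Z) (d : Ext Z A),
    push a (pull c d) = pull c (push a d);
  pushDr : forall Z A A' (a : hom A A') (d d' : Ext Z A),
    push a (d + d') = push a d + push a d';
  pullDr : forall Z Z' A (c : hom Z' Z) (d d' : Ext Z A),
    pull c (d + d') = pull c d + pull c d';
  pushDl : forall Z A A' (a a' : hom A A') (d : Ext Z A),
    push (a + a') d = push a d + push a' d;
  pullDl : forall Z Z' A (c c' : hom Z' Z) (d : Ext Z A),
    pull (c + c') d = pull c d + pull c' d
}.

Section Realization.
Context (E : biadditive_functor).

(* The extension with components (d, 0, 0, d') under the decomposition of
   E(Z + Z', A + A') as a direct sum of four groups. *)
Definition ext_bsum Z A Z' A' (d : E Z A) (d' : E Z' A') :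
    E (Z \bs Z') (A \bs A') :=
  push (inl_ A A') (pull (prl Z Z') d) + push (inr_ A A') (pull (prr Z Z') d').

Definition ext_morphism Z A Z' A' (d : E Z A) (d' : E Z' A')
    (a : hom A A') (c : hom Z Z') : Prop :=
  push a d = pull c d'.

Context (s : forall Z A : C, E Z A -> set (sequence A Z)).

Definition realizes Z A B (d : E Z A) (x : hom A B) (y : hom B Z) : Prop :=
  s d = seq_class (Sequence x y).

Definition realization : Prop :=
  (forall Z A (d : E Z A), exists B (x : hom A B) (y : hom B Z),
    realizes d x y) /\
  (forall Z A Z' A' (d : E Z A) (d' : E Z' A') (a : hom A A') (c : hom Z Z')
      B (x : hom A B) (y : hom B Z) B' (x' : hom A' B') (y' : hom B' Z'),
    ext_morphism d d' a c -> realizes d x y -> realizes d' x' y' ->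
    exists b : hom B B', b \oc x = x' \oc a /\ y' \oc b = c \oc y).

Definition additive_realization : Prop :=
  [/\ realization,
      forall Z A, s (0 : E Z A) = seq_class (split_seq A Z) &
      forall Z A Z' A' (d : E Z A) (d' : E Z' A') (t : sequence A Z)
          (t' : sequence A' Z'),
        s d = seq_class t -> s d' = seq_class t' ->
        s (ext_bsum d d') = seq_class (bsum_seq t t')].

Definition ET3 : Prop :=
  forall Z A Z' A' (d : E Z A) (d' : E Z' A')
      B (x : hom A B) (y : hom B Z) B' (x' : hom A' B') (y' : hom B' Z')
      (a : hom A A') (b : hom B B'),
    realizes d x y -> realizes d' x' y' -> b \oc x = x' \oc a ->
    exists c : hom Z Z', ext_morphism d d' a c /\ y' \oc b = c \oc y.

Definition ET3op : Prop :=
  forall Z A Z' A' (d : E Z A) (d' : E Z' A')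
      B (x : hom A B) (y : hom B Z) B' (x' : hom A' B') (y' : hom B' Z')
      (b : hom B B') (c : hom Z Z'),
    realizes d x y -> realizes d' x' y' -> y' \oc b = c \oc y ->
    exists a : hom A A', ext_morphism d d' a c /\ b \oc x = x' \oc a.

Definition ET4 : Prop :=
  forall (A B Z D F : C) (d1 : E D A) (d2 : E F B)
      (f : hom A B) (f' : hom B D) (g : hom B Z) (g' : hom Z F),
    realizes d1 f f' -> realizes d2 g g' ->
    exists (X : C) (h' : hom Z X) (d : hom D X) (e : hom X F) (d3 : E X A),
      [/\ h' \oc g = d \oc f' /\ e \oc h' = g',
          realizes d3 (g \oc f) h',
          realizes (push f' d2) d e,
          pull d d3 = d1 &
          push f d3 = pull e d2].

Definition ET4op : Prop :=
  forall (A B Z D F : C) (d1 : E B D) (d2 : E Z F)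
      (f' : hom D A) (f : hom A B) (g' : hom F B) (g : hom B Z),
    realizes d1 f' f -> realizes d2 g' g ->
    exists (X : C) (d : hom D X) (e : hom X F) (h' : hom X A) (d3 : E Z X),
      [/\ h' \oc d = f' /\ f \oc h' = g' \oc e,
          realizes d3 h' (g \oc f),
          realizes (pull g' d1) d e,
          d2 = push e d3 &
          push d d1 = pull g d3].

End Realization.

Record extriangulation := Extriangulation {
  ext_functor : biadditive_functor;
  ext_real : forall Z A : C, ext_functor Z A -> set (sequence A Z);
  ext_ET2 : additive_realization ext_real;
  ext_ET3 : ET3 ext_real;
  ext_ET3op : ET3op ext_real;
  ext_ET4 : ET4 ext_real;
  ext_ET4op : ET4op ext_real
}.

Section Extriangulated.
Context (T : extriangulation).

(* There is an E-triangle A -> B -> Z --> . *)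
Definition etriangle A B Z : Prop :=
  exists (d : ext_functor T Z A) (x : hom A B) (y : hom B Z),
    realizes (@ext_real T) d x y.

Definition generator (G : set C) : Prop :=
  forall A, exists A1 G0, G G0 /\ etriangle A1 G0 A.

Definition cogenerator (G : set C) : Prop :=
  forall A, exists G0 A1, G G0 /\ etriangle A G0 A1.

Definition resolving (G S : set C) : Prop :=
  [/\ full_additive_subcategory S,
      forall A B Z, etriangle A B Z -> S A -> S Z -> S B,
      forall A B Z, etriangle A B Z -> S B -> S Z -> S A &
      G `<=` S].

Definition coresolving (G S : set C) : Prop :=
  [/\ full_additive_subcategory S,
      forall A B Z, etriangle A B Z -> S A -> S Z -> S B,
      forall A B Z, etriangle A B Z -> S A -> S B -> S Z &
      G `<=` S].

Definition dense_resolving (G : set C) : set (set C) :=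
  [set S | dense S /\ resolving G S].

Definition dense_coresolving (G : set C) : set (set C) :=
  [set S | dense S /\ coresolving G S].

Context (I : essentially_small).

Definition K0_rel : set {freeg I} :=
  [set r | exists A B Z, etriangle A B Z /\
     r = << iso_cls I A >> + << iso_cls I Z >> - << iso_cls I B >>].

Definition K0_relsub : set {freeg I} :=
  smallest (fun H : set {freeg I} => zmod_closed (mem H)) K0_rel.

Definition K0_relpred : {pred {freeg I}} := fun r => r \in K0_relsub.

Fact K0_relpred_zmod_closed : zmod_closed K0_relpred.
Proof.
split=> [|u v].
  by apply/mem_set => H [[/set_mem H0 _] _].
move=> /set_mem Hu /set_mem Hv; apply/mem_set => H HH.
case: (HH) => -[_ HB] _; apply/set_mem.
by apply: (HB u v); apply/mem_set; [apply: Hu|apply: Hv].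
Qed.

HB.instance Definition _ :=
  GRing.isZmodClosed.Build {freeg I} K0_relpred K0_relpred_zmod_closed.

Definition K0 : zmodType := {ideal_quot K0_relpred}.

Definition K0_class X : K0 := \pi_({ideal_quot K0_relpred})%qT << iso_cls I X >>.

Definition subgroups_containing (G : set C) : set (set K0) :=
  [set H : set K0 | zmod_closed (mem H) /\ forall X, G X -> H (K0_class X)].

End Extriangulated.
End Category.

Arguments dense_resolving {K C} T G.
Arguments dense_coresolving {K C} T G.
Arguments subgroups_containing {K C} T I G.

(* Main.v *)
(** If [S] is dense and closed under extensions, the classes of objects modulo
    the relation "[A + X] is isomorphic to [B + Y] for some [X, Y] in [S]" form
    a group on which E-triangles are additive, so this group is the quotient of
    [K_0] by the subgroup [<S>] of all [[X] - [Y]] with [X, Y] in [S].  Hence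
    [[A]] lies in [<S>] iff [A + X] is isomorphic to an object of [S] for some
    [X] in [S]; the split triangles [A -> A + X -> X] and [X -> X + A -> A] then
    put [A] in [S], as soon as [S] is closed under cocones or under cones.  So
    [S] is recovered from [<S>], and resolving and coresolving mean the same for
    dense subcategories.  Conversely, if a subgroup [H] contains the classes of a
    generator or cogenerator [G], every [B] has a [B'] with [[B + B']] the class
    of an object of [G]; so the objects with class in [H] form a dense
    subcategory, and [[A] - [B] = [A + B'] - [B + B']] shows that they
    generate [H]. *)

From HB Require Import structures.
From mathcomp Require Import all_boot all_algebra.
From mathcomp Require Import freeg.
From mathcomp Require Import boolp classical_sets functions.
Require Import Defs.

Set Implicit Arguments.
Unset Strict Implicit.
Unset Printing Implicit Defensive.

Import GRing.Theory.

(** * Morphisms into biproducts as pairs, and the monoid laws of the biproduct up to isomorphism *)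

Section Biproducts.
Local Open Scope ring_scope.
Local Open Scope lincat_scope.
Context (K : fieldType) (C : linearCategory K).
Implicit Types A B X Y Z W : C.

Lemma hcompDl X Y Z (g g' : hom Y Z) (f : hom X Y) :
  (g + g') \oc f = g \oc f + g' \oc f.
Proof. by have := hcomp_linl 1 g g' f; rewrite !scale1r. Qed.

Lemma hcompDr X Y Z (g : hom Y Z) (f f' : hom X Y) :
  g \oc (f + f') = g \oc f + g \oc f'.
Proof. by have := hcomp_linr 1 g f f'; rewrite !scale1r. Qed.

Lemma hcomp0l X Y Z (f : hom X Y) : (0 : hom Y Z) \oc f = 0.
Proof. by apply: (addrI (0 \oc f)); rewrite -hcompDl !addr0. Qed.

Definition pairing X Y Z (f : hom X Y) (g : hom X Z) : hom X (Y \bs Z) :=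
  inl_ Y Z \oc f + inr_ Y Z \oc g.

Lemma prl_pairing X Y Z (f : hom X Y) (g : hom X Z) :
  prl Y Z \oc pairing f g = f.
Proof.
by rewrite hcompDr !hcompA prl_inl prl_inr hcomp1l hcomp0l addr0.
Qed.

Lemma prr_pairing X Y Z (f : hom X Y) (g : hom X Z) :
  prr Y Z \oc pairing f g = g.
Proof.
by rewrite hcompDr !hcompA prr_inl prr_inr hcomp1l hcomp0l add0r.
Qed.

Lemma pairing_comp W X Y Z (f : hom X Y) (g : hom X Z) (h : hom W X) :
  pairing f g \oc h = pairing (f \oc h) (g \oc h).
Proof. by rewrite /pairing hcompDl !hcompA. Qed.

Lemma pairing_pr X Y Z (f : hom X (Y \bs Z)) :
  pairing (prl Y Z \oc f) (prr Y Z \oc f) = f.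
Proof. by rewrite /pairing !hcompA -hcompDl bsum_id hcomp1l. Qed.

Lemma pairing_id X Y : pairing (prl X Y) (prr X Y) = idm (X \bs Y).
Proof. exact: bsum_id. Qed.

Lemma bsum_mapE X X' Y Y' (f : hom X X') (g : hom Y Y') :
  bsum_map f g = pairing (f \oc prl X Y) (g \oc prr X Y).
Proof. by rewrite /bsum_map /pairing !hcompA. Qed.

Lemma isomorphic_refl X : isomorphic X X.
Proof. by exists (idm X), (idm X); rewrite hcomp1l. Qed.

Lemma isomorphic_bsum X X' Y Y' :
  isomorphic X X' -> isomorphic Y Y' -> isomorphic (X \bs Y) (X' \bs Y').
Proof.
move=> [f [f' [f'f ff']]] [g [g' [g'g gg']]].
exists (bsum_map f g), (bsum_map f' g'); rewrite !bsum_mapE !pairing_comp.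
by rewrite -!hcompA !prl_pairing !prr_pairing !hcompA f'f ff' g'g gg' !hcomp1l
  !pairing_id.
Qed.

Lemma isomorphic_bsumC X Y : isomorphic (X \bs Y) (Y \bs X).
Proof.
by exists (pairing (prr X Y) (prl X Y)), (pairing (prr Y X) (prl Y X));
  rewrite !pairing_comp !prl_pairing !prr_pairing !pairing_id.
Qed.

Lemma isomorphic_bsumA X Y Z :
  isomorphic (X \bs (Y \bs Z)) ((X \bs Y) \bs Z).
Proof.
exists (pairing (pairing (prl _ _) (prl _ _ \oc prr _ _)) (prr _ _ \oc prr _ _)).
exists (pairing (prl _ _ \oc prl _ _) (pairing (prr _ _ \oc prl _ _) (prr _ _))).
rewrite !pairing_comp -!hcompA !(prl_pairing, prr_pairing).
by rewrite !pairing_pr !pairing_id.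
Qed.

Lemma isomorphic_bsum0 X : isomorphic (zobj \bs X) X.
Proof.
exists (prr zobj X), (pairing 0 (idm X)); split; last exact: prr_pairing.
rewrite pairing_comp hcomp0l hcomp1l -pairing_id.
by rewrite (zobj_terminal (prl zobj X)).
Qed.

End Biproducts.

(** * The commutative monoid of isomorphism classes, and formal sums of classes *)

Section IsoClasses.
Local Open Scope ring_scope.
Local Open Scope lincat_scope.
Context (K : fieldType) (C : linearCategory K) (I : essentially_small C).
Local Notation cls := (iso_cls I).
Implicit Types X Y : C.

Lemma iso_cls_eq X Y : isomorphic X Y -> cls X = cls Y.
Proof. by move/iso_clsE. Qed.

Definition iso_repr (i : I) : C := projT1 (cid (iso_cls_surj i)).

Lemma iso_reprK i : cls (iso_repr i) = i.
Proof. exact: projT2 (cid (iso_cls_surj i)). Qed.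

Definition iso_add (i j : I) : I := cls (iso_repr i \bs iso_repr j).

Lemma iso_add_cls X Y : iso_add (cls X) (cls Y) = cls (X \bs Y).
Proof.
by apply/iso_cls_eq/isomorphic_bsum; apply/(iso_clsE I); rewrite iso_reprK.
Qed.

Lemma iso_addA : associative iso_add.
Proof.
move=> i j k; rewrite -(iso_reprK i) -(iso_reprK j) -(iso_reprK k).
by rewrite !iso_add_cls; exact/iso_cls_eq/isomorphic_bsumA.
Qed.

Lemma iso_addC : commutative iso_add.
Proof. by move=> i j; exact/iso_cls_eq/isomorphic_bsumC. Qed.

Lemma iso_add0 : left_id (cls zobj) iso_add.
Proof.
move=> i; rewrite -(iso_reprK i) iso_add_cls.
exact/iso_cls_eq/isomorphic_bsum0.
Qed.

HB.instance Definition _ :=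
  Monoid.isComLaw.Build I (cls zobj) iso_add iso_addA iso_addC iso_add0.

Lemma iso_addCA : left_commutative iso_add.
Proof. exact: Monoid.mulmCA. Qed.

Lemma iso_addACA : interchange iso_add iso_add.
Proof. exact: Monoid.mulmACA. Qed.

Definition iso_sum (s : seq I) : I := \big[iso_add/cls zobj]_(i <- s) i.

Definition free_sum (s : seq I) : {freeg I} := \sum_(i <- s) << i >>.

(** The coefficient of [x] in [free_sum s] is the multiplicity of [x] in [s]. *)
Lemma free_sum_perm s t : free_sum s = free_sum t -> perm_eq s t.
Proof.
have coeffE x r : coeff x (free_sum r) = (count_mem x r)%:Z.
  elim: r => [|i r IHr]; rewrite /free_sum ?big_nil ?coeff0// big_cons.
  by rewrite coeffD coeffU mul1r [coeff _ _]IHr /= PoszD natz.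
move=> st; apply/allP => x _ /=; apply/eqP.
by have := coeffE x s; rewrite st coeffE => -[].
Qed.

Lemma free_sum_cat s t : free_sum (s ++ t) = free_sum s + free_sum t.
Proof. by rewrite /free_sum big_cat. Qed.

Lemma iso_sum_cat s t : iso_sum (s ++ t) = iso_add (iso_sum s) (iso_sum t).
Proof. by rewrite /iso_sum big_cat. Qed.

(** Turns an identity in the free group, once free of negative terms, into an isomorphism of direct
    sums. *)
Lemma free_sum_iso_sum s t : free_sum s = free_sum t -> iso_sum s = iso_sum t.
Proof. by move/free_sum_perm; apply: perm_big. Qed.

End IsoClasses.

(** * Classes in [K0], and the two maps between subcategories and subgroups *)

Section Correspondence.
Local Open Scope classical_set_scope.
Local Open Scope ring_scope.
Local Open Scope lincat_scope.
Context (K : fieldType) (C : linearCategory K) (T : extriangulation C).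
Context (I : essentially_small C).
Local Notation cls := (iso_cls I).
Local Notation add := (@iso_add K C I).
Local Notation k0 := (K0_class T I).
Implicit Types (A B X Y Z : C) (G S : set C) (H : set (K0 T I)).

Lemma etriangle_split A Z : etriangle T A (A \bs Z) Z.
Proof.
exists 0, (inl_ A Z), (prr A Z).
by case: (ext_ET2 T) => _ + _; apply.
Qed.

Lemma etriangle_bsum A B Z A' B' Z' :
  etriangle T A B Z -> etriangle T A' B' Z' ->
  etriangle T (A \bs A') (B \bs B') (Z \bs Z').
Proof.
move=> [d [x [y dxy]]] [d' [x' [y' dxy']]].
exists (ext_bsum d d'), (bsum_map x x'), (bsum_map y y').
by case: (ext_ET2 T) => _ _ /(_ _ _ _ _ _ _ _ _ dxy dxy').
Qed.

Lemma K0_class_iso X Y : isomorphic X Y -> k0 X = k0 Y.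
Proof. by rewrite /K0_class => /(iso_cls_eq I) ->. Qed.

Lemma K0_class_etriangle A B Z : etriangle T A B Z -> k0 B = k0 A + k0 Z.
Proof.
move=> ABZ; apply/esym/eqP; rewrite /K0_class -raddfD /=.
rewrite -Quotient.idealrBE; apply: mem_set; apply: sub_gen_smallest.
by exists A, B, Z.
Qed.

Lemma K0_class_bsum X Y : k0 (X \bs Y) = k0 X + k0 Y.
Proof. exact/K0_class_etriangle/etriangle_split. Qed.

Lemma K0_class0 : k0 zobj = 0.
Proof.
apply: (addrI (k0 zobj)); rewrite -K0_class_bsum addr0.
exact/K0_class_iso/isomorphic_bsum0.
Qed.

Lemma K0_classB (u : K0 T I) : exists X Y, u = k0 X - k0 Y.
Proof.
pose P (v : K0 T I) := exists X Y, v = k0 X - k0 Y.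
have P0 : P 0 by exists zobj, zobj; rewrite subrr.
have PN v : P v -> P (- v) by move=> [X [Y ->]]; exists Y, X; rewrite opprB.
have PD v w : P v -> P w -> P (v + w).
  move=> [X [Y ->]] [X' [Y' ->]]; exists (X \bs X'), (Y \bs Y').
  by rewrite !K0_class_bsum opprD addrACA.
have [v ->] : exists v, u = \pi_({ideal_quot @K0_relpred K C T I})%qT v.
  by exists (repr u); rewrite reprK.
rewrite -[v]freeg_sumE raddf_sum; apply: (big_ind P) => // i _.
have [X <-] := iso_cls_surj i.
have Pn n : P (k0 X *+ n).
  elim: n => [|n IHn]; rewrite ?mulr0n// mulrS; apply: PD => //.
  by exists X, zobj; rewrite K0_class0 subr0.
(* The term is an integer multiple of [k0 X]; a negative coefficient is reduced to a positive one by
   [PN]. *)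
rewrite -[coeff _ _]intz -freegU_mulz raddfMz /=.
by case: (coeff _ _) => n; [exact: Pn|exact/PN/Pn].
Qed.

Definition class_preimage H : set C := [set X | H (k0 X)].

Definition class_span S : set (K0 T I) :=
  [set u | exists X Y, [/\ S X, S Y & u = k0 X - k0 Y]].

(** * Dense extension-closed subcategories: recovering [S] from its span *)

Section DenseExtensionClosed.
Context (S : set C).
Hypotheses (S_add : full_additive_subcategory S) (S_dense : dense S).
Hypothesis S_ext : forall A B Z, etriangle T A B Z -> S A -> S Z -> S B.

Let S0 : S zobj. Proof. by case: S_add. Qed.
Let SD X Y : S X -> S Y -> S (X \bs Y).
Proof. by case: S_add => _ /(_ X Y). Qed.
Let S_cls X Y : cls X = cls Y -> S X -> S Y.
Proof. by case: S_add => _ _ /(_ X Y) SXY /iso_clsE /SXY. Qed.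

Lemma dense_complement A : exists A', S (A \bs A').
Proof.
have [X [SX [A' XAA']]] := S_dense A; exists A'.
by case: S_add => _ _ /(_ _ _ XAA'); apply.
Qed.

(** The kernel of the map from the free group to the group of classes modulo [S], described without
    constructing that group. *)
Definition stably_trivial (v : {freeg I}) : Prop :=
  exists (s t : seq I) X Y, [/\ S X, S Y, v = free_sum s - free_sum t &
    add (iso_sum s) (cls X) = add (iso_sum t) (cls Y)].

Lemma stably_trivial0 : stably_trivial 0.
Proof. by exists [::], [::], zobj, zobj; rewrite subrr. Qed.

Lemma stably_trivialB u v :
  stably_trivial u -> stably_trivial v -> stably_trivial (u - v).
Proof.
move=> [s [t [X [Y [SX SY -> st]]]]] [s' [t' [X' [Y' [SX' SY' -> st']]]]].
exists (s ++ t'), (t ++ s'), (X \bs Y'), (Y \bs X'); split; try exact: SD.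
  by rewrite !free_sum_cat opprB opprD addrACA.
rewrite !iso_sum_cat -!iso_add_cls.
by rewrite Monoid.mulmACA /= st -st' Monoid.mulmACA.
Qed.

(* With [A + A'] and [Z + Z'] in [S], the triangle
   [A + A' -> B + (A' + Z') -> Z + Z'] puts its middle term in [S], and then
   [A + Z + (B + (A' + Z'))] and [B + ((A + A') + (Z + Z'))] are isomorphic. *)
Lemma stably_trivial_etriangle A B Z : etriangle T A B Z ->
  stably_trivial (<< cls A >> + << cls Z >> - << cls B >>).
Proof.
move=> ABZ; have [A' SA] := dense_complement A.
have [Z' SZ] := dense_complement Z.
have SB := S_ext (etriangle_bsum ABZ (etriangle_split A' Z')) SA SZ.
exists [:: cls A; cls Z], [:: cls B].
exists (B \bs (A' \bs Z')), ((A \bs A') \bs (Z \bs Z')).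
split=> //; first exact: SD.
  by rewrite /free_sum !big_cons !big_nil !addr0.
rewrite /iso_sum !big_cons !big_nil !Monoid.mulm1 -!iso_add_cls.
by rewrite iso_addCA (iso_addACA (cls A)).
Qed.

(** The stably trivial elements form a subgroup containing the relations of [K0], hence also the
    subgroup these generate. *)
Lemma stably_trivial_K0 u v :
  u = v %[mod {ideal_quot @K0_relpred K C T I}]%qT -> stably_trivial (u - v).
Proof.
move/eqP; rewrite -Quotient.idealrBE => /set_mem.
apply: (smallest_sub (X := stably_trivial)); last first.
  by move=> _ [A [B [Z [ABZ ->]]]]; exact: stably_trivial_etriangle.
split=> [|x y /set_mem xS /set_mem yS]; apply/mem_set.
  exact: stably_trivial0.
exact: stably_trivialB.
Qed.

Lemma class_span_absorb A :
  class_span S (k0 A) -> exists X, S X /\ S (A \bs X).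
Proof.
move=> [X [Y [SX SY /eqP]]]; rewrite -subr_eq opprK -!raddfD => /eqP.
move=> /stably_trivial_K0 [s [t [Z [W [SZ SW]]]]].
have sum1 (i : I) : free_sum [:: i] = << i >> by rewrite /free_sum big_seq1.
(* Negative terms change sides, so that [ee] reads [s + X = (A + Y) + t] on isomorphism classes. *)
rewrite -!sum1 -free_sum_cat => /eqP; rewrite subr_eq addrAC eq_sym subr_eq.
rewrite -!free_sum_cat => /eqP /free_sum_iso_sum; rewrite !iso_sum_cat.
rewrite /iso_sum !big_seq1 -/(iso_sum s) -/(iso_sum t) => ee st.
(* From [ee] and [st], [A + Y + Z + t = X + W + t]. The common summand [t] is not cancelled: a
   complement [B'] completes it to an object of [S] on both sides. *)
pose B := iso_repr (iso_sum t); have [B' SB] := dense_complement B.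
exists ((B \bs B') \bs (Y \bs Z)).
split; first by apply: SD => //; exact: SD.
apply: (S_cls (X := (B \bs B') \bs (X \bs W))); last first.
  by apply: SD => //; exact: SD.
rewrite -!iso_add_cls !iso_reprK (iso_addC (cls X)) iso_addACA -st.
rewrite (iso_addC (cls B')) iso_addACA ee (iso_addACA (iso_sum t)).
by rewrite (iso_addC (iso_sum t)) (iso_addC (cls B')) !iso_addA.
Qed.

End DenseExtensionClosed.

(** The last hypothesis is the form of cancellation that closure under cocones and closure under
    cones both provide. *)
Lemma class_spanK S : full_additive_subcategory S -> dense S ->
    (forall A B Z, etriangle T A B Z -> S A -> S Z -> S B) ->
    (forall A X, S (A \bs X) -> S X -> S A) ->
  class_preimage (class_span S) = S.
Proof.
move=> S_add S_dense S_ext S_cancel; apply/seteqP; split=> A /=.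
  by move=> /(class_span_absorb S_add S_dense S_ext) [X [SX /S_cancel]]; apply.
case: S_add => S0 _ _ SA; exists A, zobj; split=> //.
by rewrite K0_class0 subr0.
Qed.

Lemma class_span_zmod_closed S :
  full_additive_subcategory S -> zmod_closed (mem (class_span S)).
Proof.
move=> [S0 SD _]; split=> [|u v].
  by apply/mem_set; exists zobj, zobj; rewrite subrr.
move=> /set_mem [X [Y [SX SY ->]]] /set_mem [X' [Y' [SX' SY' ->]]].
apply/mem_set; exists (X \bs Y'), (Y \bs X'); split; try exact: SD.
by rewrite !K0_class_bsum opprB opprD addrACA.
Qed.

Lemma dense_resolving_class_span G S :
  dense_resolving T G S ->
  subgroups_containing T I G (class_span S) /\ class_preimage (class_span S) = S.
Proof.
move=> [S_dense [S_add S_ext S_cocone GS]]; split; last first.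
  apply: class_spanK => // A X SAX SX.
  exact: S_cocone (etriangle_split A X) SAX SX.
split; first exact: class_span_zmod_closed.
move=> X GX; exists X, zobj; case: S_add => S0 _ _.
by split; [exact: GS|exact: S0|rewrite K0_class0 subr0].
Qed.

Lemma dense_coresolving_class_span G S :
  dense_coresolving T G S ->
  subgroups_containing T I G (class_span S) /\ class_preimage (class_span S) = S.
Proof.
move=> [S_dense [S_add S_ext S_cone GS]]; split; last first.
  apply: class_spanK => // A X SAX SX.
  apply: S_cone (etriangle_split X A) SX _.
  by case: S_add => _ _ /(_ _ _ (isomorphic_bsumC A X)); apply.
split; first exact: class_span_zmod_closed.
move=> X GX; exists X, zobj; case: S_add => S0 _ _.
by split; [exact: GS|exact: S0|rewrite K0_class0 subr0].
Qed.

(** * Subgroups containing the classes of [G], and their preimages *)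

Section Subgroup.
Context (G : set C) (G_gen : generator T G \/ cogenerator T G).
Context (H : set (K0 T I)) (HG : subgroups_containing T I G H).

Let H0 : H 0. Proof. by case: HG => -[/set_mem]. Qed.
Let HB u v : H u -> H v -> H (u - v).
Proof.
case: HG => -[_ /(_ u v)] HB _ Hu Hv.
by apply/set_mem; apply: HB; apply/mem_set.
Qed.
Let HD u v : H u -> H v -> H (u + v).
Proof.
by move=> Hu Hv; rewrite -[v]opprK -(sub0r v); apply: HB => //; exact: HB.
Qed.
Let HG1 X : G X -> H (k0 X). Proof. by case: HG => _; apply. Qed.

(** [A] is an end term of a triangle with middle term in [G]; in [K0] it does not matter which end,
    so generators and cogenerators serve equally. *)
Lemma class_complement A : exists A', H (k0 (A \bs A')).
Proof.
case: G_gen => /(_ A).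
  move=> [A' [X [GX /K0_class_etriangle XE]]]; exists A'.
  by rewrite K0_class_bsum addrC -XE; exact: HG1.
move=> [X [A' [GX /K0_class_etriangle XE]]]; exists A'.
by rewrite K0_class_bsum -XE; exact: HG1.
Qed.

Lemma class_preimage_dense : dense (class_preimage H).
Proof.
move=> A; have [A' HA] := class_complement A.
by exists (A \bs A'); split=> //; exists A'; exact: isomorphic_refl.
Qed.

Lemma class_preimage_add : full_additive_subcategory (class_preimage H).
Proof.
split=> [|X Y HX HY|X Y /K0_class_iso XY]; rewrite /class_preimage /=.
- by rewrite K0_class0.
- by rewrite K0_class_bsum; exact: HD.
- by rewrite XY.
Qed.

Lemma class_preimage_ext A B Z : etriangle T A B Z ->
  class_preimage H A -> class_preimage H Z -> class_preimage H B.
Proof.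
move=> /K0_class_etriangle BE HA HZ; rewrite /class_preimage /= BE.
exact: HD.
Qed.

Lemma class_preimage_resolving : dense_resolving T G (class_preimage H).
Proof.
split; first exact: class_preimage_dense.
split; [exact: class_preimage_add|exact: class_preimage_ext| |exact: HG1].
move=> A B Z /K0_class_etriangle BE HB' HZ; rewrite /class_preimage /=.
by rewrite -[k0 A](addrK (k0 Z)) -BE; exact: HB.
Qed.

Lemma class_preimage_coresolving : dense_coresolving T G (class_preimage H).
Proof.
split; first exact: class_preimage_dense.
split; [exact: class_preimage_add|exact: class_preimage_ext| |exact: HG1].
move=> A B Z /K0_class_etriangle BE HA HB'; rewrite /class_preimage /=.
by rewrite -[k0 Z](addKr (k0 A)) addrC -BE; exact: HB.
Qed.

Lemma class_preimageK : class_span (class_preimage H) = H.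
Proof.
apply/seteqP; split=> [_ [X [Y [HX HY ->]]]|u Hu]; first exact: HB.
(* Adding [Y'] to both objects keeps the difference [u] and puts the class of the second in [H];
   that of the first follows since [u] is in [H]. *)
have [X [Y uE]] := K0_classB u; have [Y' HY] := class_complement Y.
have uE' : u = k0 (X \bs Y') - k0 (Y \bs Y').
  by rewrite !K0_class_bsum opprD addrACA subrr addr0.
exists (X \bs Y'), (Y \bs Y'); split=> //; rewrite /class_preimage /=.
by rewrite -[k0 _](subrK (k0 (Y \bs Y'))) -uE'; exact: HD.
Qed.

End Subgroup.

(** * The bijections *)

Lemma dense_resolvingE G : generator T G \/ cogenerator T G ->
  dense_resolving T G = dense_coresolving T G.
Proof.
move=> G_gen; apply/seteqP; split=> S.
  (* [S] is the preimage of its span, a subgroup containing the classes of [G], and the preimage of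
     such a subgroup is both resolving and coresolving. *)
  move=> /dense_resolving_class_span [HG <-].
  exact: class_preimage_coresolving.
move=> /dense_coresolving_class_span [HG <-].
exact: class_preimage_resolving.
Qed.

Lemma class_span_bij G : generator T G \/ cogenerator T G ->
  set_bij (dense_resolving T G) (subgroups_containing T I G) class_span.
Proof.
move=> G_gen; split.
- by move=> S /dense_resolving_class_span [].
- move=> S S' /set_mem /dense_resolving_class_span [_ SE].
  by move=> /set_mem /dense_resolving_class_span [_ SE'] e; rewrite -SE e.
- move=> H HG; exists (class_preimage H).
    exact: class_preimage_resolving.
  exact: class_preimageK G_gen _ HG.
Qed.

End Correspondence.

Theorem theorem5p7 (K : fieldType) (C : linearCategory K)
    (I : essentially_small C) (T : extriangulation C) (G : set C) :
  krull_schmidt C ->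
  generator T G \/ cogenerator T G ->
  [/\ exists f : set C -> set C,
        set_bij (dense_resolving T G) (dense_coresolving T G) f,
      exists f : set C -> set (K0 T I),
        set_bij (dense_resolving T G) (subgroups_containing T I G) f &
      exists f : set C -> set (K0 T I),
        set_bij (dense_coresolving T G) (subgroups_containing T I G) f].
Proof.
move=> _ G_gen; have span_bij := class_span_bij I G_gen.
rewrite -(dense_resolvingE I G_gen); split.
(* The two sets of subcategories are now the same set. *)
- by exists id; split=> // S GS; exists S.
- by exists (@class_span K C T I).
- by exists (@class_span K C T I).
Qed.
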